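(* Consider the scalar system $x_{t+1}=x_t+u_t+w_t$, $y_t=|x_t|$, $t\ge 0$, with $x_t,u_t,w_t\in\mathbb{R}$. (i) Let $\gamma>0$. There exists an admissible (causal) policy $u_t=\mu_t(y_0,\dots,y_t,u_0,\dots,u_{t-1})$ that ensures $\ell_2$-gain smaller than $\gamma$ if and only if $\ell_2$-gain smaller than $\gamma$ is achievable with a policy of the form $u_t=\eta_t(y_t,r_t^+,r_t^-)$, where $\eta_t:\mathbb{R}_{\ge 0}\times\mathbb{R}\times\mathbb{R}\to\mathbb{R}$ and the quantities $r_t^+,r_t^-$ are generated recursively by $r_0^+=r_0^-=0$ and $$r^+_{t+1}=y_t^2+u_t^2+\max\{r_t^+-\gamma^2(y_{t+1}-u_t-y_t)^2,\; r_t^--\gamma^2(y_{t+1}-u_t+y_t)^2\},$$ $$r^-_{t+1}=y_t^2+u_t^2+\max\{r_t^+-\gamma^2(-y_{t+1}-u_t-y_t)^2,\; r_t^--\gamma^2(-y_{t+1}-u_t+y_t)^2\}.$$ (ii) Further, the controller $u_t=\eta(y_t,r_t^+,r_t^-)$ with $\eta(y,r^+,r^-)=0.7\,\operatorname{sign}(r^--r^+)\,y$, where $r_t^\pm$ are generated by $r_0^+=r_0^-=0$ and $$r^+_{t+1}=y_t^2+u_t^2+\max\{r_t^+-\gamma^2(y_{t+1}-u_t-y_t)^2,\; r_t^--\gamma^2(y_{t+1}-u_t+y_t)^2\},$$ $$r^-_{t+1}=y_t^2+u_t^2+\max\{r_t^+-\gamma^2(-y_{t+1}-u_t-y_t)^2,\;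 r_t^--\gamma^2(-y_{t+1}-u_t+y_t)^2\}$$ with $\gamma=4$, achieves $\ell_2$-gain less than $4$.
   Context: An admissible policy is a sequence of functions $\mu_t$ mapping $(y_0,\dots,y_t,u_0,\dots,u_{t-1})$ to $u_t\in\mathbb{R}$. A policy is said to ensure (achieve) $\ell_2$-gain smaller than (less than) $\gamma$ if there is a real-valued function $\beta:\mathbb{R}\to\mathbb{R}$ (a bias term) such that, for the resulting closed loop, $$\sum_{t=0}^N (x_t^2+u_t^2)\le \gamma^2\sum_{t=0}^N w_t^2+\beta(x_0)$$ for all $N\ge 0$, all initial states $x_0\in\mathbb{R}$ and all disturbance realizations $w_0,\dots,w_N\in\mathbb{R}$. The sign function takes values in $\{-1,1\}$, with $\operatorname{sign}(z)=1$ for $z>0$, $\operatorname{sign}(z)=-1$ for $z<0$, and $\operatorname{sign}(0)$ a fixed choice in $\{-1,1\}$. Since $r_t^\pm$ are functions of past and current measurements and past controls, policies of the form $\eta_t(y_t,r_t^+,r_t^-)$ are admissible. *)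

(* Defs.v *)
From HB Require Import structures.
From mathcomp Require Import all_boot all_order all_algebra.
From mathcomp Require Import all_reals interval_inference.

Set Implicit Arguments.
Unset Strict Implicit.
Unset Printing Implicit Defensive.

Import Order.TTheory GRing.Theory Num.Theory.

Local Open Scope ring_scope.

(* [mu t ys us] is the control u_t chosen from the measurements
   ys = (y_0, .., y_t) and the past controls us = (u_0, .., u_{t-1}). *)
Definition policy (R : realType) : Type :=
  forall t : nat, t.+1.-tuple {nonneg R} -> t.-tuple R -> R.

Definition measurement (R : realType) (x : R) : {nonneg R} := `|x|%:nng.

Definition closed_loop (R : realType) (mu : policy R) (w x u : nat -> R) : Prop :=
  forall t : nat,
    u t = mu t [tuple measurement (x i) | i < t.+1] [tuple u i | i < t] /\
    x t.+1 = x t + u t + w t.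

(* Trajectories are indexed by infinite disturbance sequences; since the loop
   is causal, the inequality at horizon N involves w_0, .., w_N only. *)
Definition ensures_l2_gain (R : realType) (mu : policy R) (gamma : R) : Prop :=
  exists beta : R -> R,
    forall w x u : nat -> R, closed_loop mu w x u ->
    forall N : nat,
      \sum_(0 <= t < N.+1) (x t ^+ 2 + u t ^+ 2)
        <= gamma ^+ 2 * (\sum_(0 <= t < N.+1) w t ^+ 2) + beta (x 0%N).

(* The pair (r_t^+, r_t^-); it depends only on y_0, .., y_t and
   u_0, .., u_{t-1}. *)
Fixpoint info_state (R : realType) (gamma : R) (y u : nat -> R) (t : nat)
    : R * R :=
  match t with
  | 0 => (0, 0)
  | s.+1 =>
    let rp := (info_state gamma y u s).1 in
    let rm := (info_state gamma y u s).2 in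
    (y s ^+ 2 + u s ^+ 2 +
       Num.max (rp - gamma ^+ 2 * (y s.+1 - u s - y s) ^+ 2)
               (rm - gamma ^+ 2 * (y s.+1 - u s + y s) ^+ 2),
     y s ^+ 2 + u s ^+ 2 +
       Num.max (rp - gamma ^+ 2 * (- y s.+1 - u s - y s) ^+ 2)
               (rm - gamma ^+ 2 * (- y s.+1 - u s + y s) ^+ 2))
  end.

(* The policy u_t = eta_t(y_t, r_t^+, r_t^-). The default values of [nth] are
   never reached: [info_state _ _ _ t] reads y up to t and u up to t - 1. *)
Definition info_policy (R : realType) (gamma : R)
    (eta : nat -> {nonneg R} -> R -> R -> R) : policy R :=
  fun t ys us =>
    let y := fun i : nat => (nth 0%:nng ys i)%:num in
    let u := fun i : nat => nth 0 us i in
    let r := info_state gamma y u t in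
    eta t (tnth ys ord_max) r.1 r.2.

(* [s0] is the chosen value of sign(0). *)
Definition sign (R : realType) (s0 z : R) : R :=
  if 0 < z then 1 else if z < 0 then -1 else s0.

(* Main.v *)
Require Import Defs.
From HB Require Import structures.
From mathcomp Require Import all_boot all_order all_algebra.
From mathcomp Require Import boolp classical_sets.
From mathcomp Require Import all_reals interval_inference.
From mathcomp Require Import ring lra.

Import Order.TTheory GRing.Theory Num.Theory.
Local Open Scope ring_scope.

(** The pair r_t = (r_t^+, r_t^-) is the worst-case past: r_t^+ (resp. r_t^-)
    is the largest net cost, the sum over s < t of
    x_s^2 + u_s^2 - gamma^2 w_s^2, over all state trajectories that have
    produced the observed measurements and end in x_t = y_t (resp. - y_t).
    The upper bound is [net_cost_le_info] and its attainment is
    [worst_case_history]. Since the last disturbance may be 0, a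
    gain bound amounts to keeping
    y_t^2 + u_t^2 + max (r_t^+, r_t^-) below a constant depending on y_0, for
    every measurement sequence. This is a full-information game with
    state (y_t, r_t), where the adversary picks y_{t+1}; [gain_of_certificate]
    is the corresponding sufficient condition on a policy.

    For the first part, a bound b is achievable from a state of this game
    exactly when the state lies in a set from which some control pays at
    most b and stays in the set whatever the adversary does. The states
    reached under an arbitrary policy with finite gain form such a set
    ([winning_of_gain]), so every initial state has a finite value. A
    feedback on (y, r) is then obtained by choosing at time t a control whose
    guarantee exceeds the value of the current state by at most 2^-(t+1)
    ([near_optimal_control]). The infimum need not be attained, but these
    losses add up to at most 1, which the bias term absorbs.

    For the second part, suppose that r^+ >= r^-, the other case being
    symmetric. The controller then acts as if x = y. The quantity
    max (max (r^+, r^-) + 1.7 y^2, min (r^+, r^-) + 7 y^2) bounds the cost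
    and does not increase along the loop: a wrong guess of the sign costs at
    most 7 y^2, and when a small r^- makes a wrong guess harmless, 1.7 y^2 is
    enough ([quadratic_cert_step]). *)

(** * The worst-case past *)

Definition info_next {R : realType} (gamma y u y' : R) (r : R * R) : R * R :=
  (y ^+ 2 + u ^+ 2 +
     Num.max (r.1 - gamma ^+ 2 * (y' - u - y) ^+ 2)
             (r.2 - gamma ^+ 2 * (y' - u + y) ^+ 2),
   y ^+ 2 + u ^+ 2 +
     Num.max (r.1 - gamma ^+ 2 * (- y' - u - y) ^+ 2)
             (r.2 - gamma ^+ 2 * (- y' - u + y) ^+ 2)).

Lemma info_stateS {R : realType} (gamma : R) (y u : nat -> R) (t : nat) :
  info_state gamma y u t.+1 =
  info_next gamma (y t) (u t) (y t.+1) (info_state gamma y u t).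
Proof. by []. Qed.

Lemma eq_info_state {R : realType} (gamma : R) (y y' u u' : nat -> R) (t : nat) :
  (forall i, (i <= t)%N -> y i = y' i) -> (forall i, (i < t)%N -> u i = u' i) ->
  info_state gamma y u t = info_state gamma y' u' t.
Proof.
elim: t => // t IH yE uE; rewrite !info_stateS !yE ?uE ?leqnSn //.
by rewrite IH // => i it; [apply: yE; apply: leqW | apply: uE; apply: ltnW].
Qed.

(** The disturbance has been eliminated through w_s = x_{s+1} - x_s - u_s. *)
Definition net_cost {R : realType} (gamma : R) (x u : nat -> R) (t : nat) : R :=
  \sum_(0 <= s < t)
    (x s ^+ 2 + u s ^+ 2 - gamma ^+ 2 * (x s.+1 - x s - u s) ^+ 2).

Lemma net_costS {R : realType} (gamma : R) (x u : nat -> R) (t : nat) :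
  net_cost gamma x u t.+1 = net_cost gamma x u t +
    (x t ^+ 2 + u t ^+ 2 - gamma ^+ 2 * (x t.+1 - x t - u t) ^+ 2).
Proof. by rewrite /net_cost big_nat_recr. Qed.

Lemma eq_net_cost {R : realType} (gamma : R) (x x' u u' : nat -> R) (t : nat) :
  (forall i, (i <= t)%N -> x i = x' i) -> (forall i, (i < t)%N -> u i = u' i) ->
  net_cost gamma x u t = net_cost gamma x' u' t.
Proof.
move=> xE uE; apply: eq_big_nat => i /andP[_ it].
by rewrite !xE ?uE // ltnW.
Qed.

Lemma gain_net_costE {R : realType} (gamma b : R) (x u w : nat -> R) (N : nat) :
  (forall t, x t.+1 = x t + u t + w t) ->
  (\sum_(0 <= t < N) (x t ^+ 2 + u t ^+ 2)
     <= gamma ^+ 2 * (\sum_(0 <= t < N) w t ^+ 2) + b)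
  = (net_cost gamma x u N <= b).
Proof.
move=> xS; rewrite -lerBlDl mulr_sumr -sumrB; congr (_ <= b).
by apply: eq_bigr => i _; rewrite xS; ring.
Qed.

(** A trajectory leaves time [t] from one of the two signs of its state
    there, and each branch of the maximum defining the next information state
    accounts for one of them. *)
Lemma net_cost_le_info {R : realType} (gamma : R) (x u : nat -> R) (t : nat) :
  let r := info_state gamma (fun i => `|x i|) u t in
  (x t = `|x t| -> net_cost gamma x u t <= r.1) /\
  (x t = - `|x t| -> net_cost gamma x u t <= r.2).
Proof.
elim: t => [|t [IHp IHm]] /=; first by rewrite /net_cost big_geq.
rewrite net_costS real_normK ?num_real // addrCA; set y' := `|x t.+1|.
have [xt|xt] : x t = `|x t| \/ x t = - `|x t|.
  by case: (ger0P (x t)) => _; [left | right; rewrite opprK].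
- move: (IHp xt); set r := info_state _ _ _ _; rewrite -xt => le_r.
  by split=> ->; rewrite lerD2l le_max [_ - x t - u t]addrAC lerD2r le_r.
- move: (IHm xt); set r := info_state _ _ _ _ => le_r.
  have nxt : `|x t| = - x t by rewrite {2}xt opprK.
  by split=> ->; rewrite nxt lerD2l le_max [_ - x t - u t]addrAC lerD2r le_r orbT.
Qed.

(** Following backwards the branch that attains the maximum at each step
    selects the signs of a trajectory whose net cost is exactly the
    information state. *)
Lemma worst_case_history {R : realType} (gamma : R) (y : nat -> {nonneg R})
    (u : nat -> R) (t : nat) :
  let r := info_state gamma (fun i => (y i)%:num) u t in
  (exists x : nat -> R, [/\ forall i, measurement (x i) = y i,
      x t = (y t)%:num & net_cost gamma x u t = r.1]) /\
  (exists x : nat -> R, [/\ forall i, measurement (x i) = y i,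
      x t = - (y t)%:num & net_cost gamma x u t = r.2]).
Proof.
(* A history up to [s] can be prolonged by either sign of y_{s+1}; the values
   after [s.+1] only have to match the measurements. *)
have splice (x : nat -> R) (s : nat) (e : R) : `|e| = 1 ->
    (forall i, measurement (x i) = y i) ->
    exists x' : nat -> R, [/\ forall i, measurement (x' i) = y i,
      x' s = x s, x' s.+1 = e * (y s.+1)%:num &
      net_cost gamma x' u s = net_cost gamma x u s].
  move=> e1 xy; exists (fun i => if (i <= s)%N then x i else e * (y i)%:num).
  split=> [i| | |]; rewrite ?leqnn ?ltnn //.
  - case: ifP => // _; apply/val_inj; rewrite /= normrM e1 mul1r.
    by rewrite ger0_norm.
  - by apply: eq_net_cost => // i ->.
have one1 : `|1 : R| = 1 by rewrite normr1.
have oneN1 : `|-1 : R| = 1 by rewrite normrN1.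
elim: t => [|t [[xp [xpy xpt xpr]] [xm [xmy xmt xmr]]]] /=.
  by split; [exists (fun i => (y i)%:num) | exists (fun i => - (y i)%:num)];
    split=> // [i|]; rewrite /net_cost ?big_geq //;
    apply/val_inj; rewrite /= ?normrN ger0_norm.
move: xpr xmr; set r := info_state _ _ _ _ => xpr xmr.
split; rewrite maxEle; case: ifP => _.
- have [x [xy xt xt1 xE]] := splice xm t 1 one1 xmy.
  by exists x; split; rewrite // ?net_costS ?xE ?xt ?xt1 ?xmr ?xmt; ring.
- have [x [xy xt xt1 xE]] := splice xp t 1 one1 xpy.
  by exists x; split; rewrite // ?net_costS ?xE ?xt ?xt1 ?xpr ?xpt; ring.
- have [x [xy xt xt1 xE]] := splice xm t (-1) oneN1 xmy.
  by exists x; split; rewrite // ?net_costS ?xE ?xt ?xt1 ?xmr ?xmt; ring.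
- have [x [xy xt xt1 xE]] := splice xp t (-1) oneN1 xpy.
  by exists x; split; rewrite // ?net_costS ?xE ?xt ?xt1 ?xpr ?xpt; ring.
Qed.

(** * Closed loops driven by measurements *)

(** A policy can be run on an arbitrary measurement sequence, without
    reference to a state trajectory; the list of past controls is
    carried along because each control depends on all of them. *)
Fixpoint past_controls {R : realType} (mu : policy R) (y : nat -> {nonneg R})
    (t : nat) : t.-tuple R :=
  match t with
  | 0 => [tuple]
  | s.+1 => [tuple of rcons (past_controls mu y s)
               (mu s [tuple y i | i < s.+1] (past_controls mu y s))]
  end.

Definition control {R : realType} (mu : policy R) (y : nat -> {nonneg R})
    (t : nat) : R :=
  mu t [tuple y i | i < t.+1] (past_controls mu y t).

Lemma past_controlsE {R : realType} (mu : policy R) (y : nat -> {nonneg R})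
    (t : nat) :
  past_controls mu y t = [tuple control mu y i | i < t].
Proof.
apply/val_inj; rewrite /= (map_comp (control mu y) val) val_enum_ord.
elim: t => //= t IH; rewrite IH -/(control mu y t) -map_rcons.
by rewrite -cats1 -(iotaD 0 t 1) addn1.
Qed.

Lemma eq_control {R : realType} (mu : policy R) (y y' : nat -> {nonneg R})
    (t : nat) :
  (forall i, (i <= t)%N -> y i = y' i) -> control mu y t = control mu y' t.
Proof.
move=> yE; rewrite /control.
have measE s : (s <= t)%N ->
    [tuple y i | i < s.+1] = [tuple y' i | i < s.+1].
  move=> st; apply: eq_mktuple => i; apply: yE.
  by rewrite (leq_trans _ st) // -ltnS.
have pastE s : (s <= t)%N -> past_controls mu y s = past_controls mu y' s.
  elim: s => // s IH st; apply/val_inj; rewrite /= IH ?(ltnW st) //.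
  by rewrite (measE s (ltnW st)).
by rewrite (measE t) // pastE.
Qed.

(** The disturbance is unconstrained, so every sequence of states is a
    trajectory of the loop. *)
Lemma closed_loop_control {R : realType} (mu : policy R) (x : nat -> R) :
  let u := control mu (measurement (R := R) \o x) in
  closed_loop mu (fun t => x t.+1 - x t - u t) x u.
Proof.
move=> u t; split; last by ring.
by rewrite [LHS]/u /control past_controlsE.
Qed.

Lemma info_policy_loop {R : realType} (gamma : R)
    (eta : nat -> {nonneg R} -> R -> R -> R) (w x u : nat -> R) (t : nat) :
  closed_loop (info_policy gamma eta) w x u ->
  let r := info_state gamma (fun i => `|x i|) u t in
  u t = eta t (measurement (x t)) r.1 r.2.
Proof.
move=> loop r; have [-> _] := loop t.
rewrite /info_policy tnth_mktuple.
(* The default value is generalized because the literal 0 carries a proof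
   term that would prevent matching. *)
suff nthE (z : {nonneg R}) : info_state gamma
    (fun i => (nth z [tuple measurement (x i) | i < t.+1] i)%:num)
    (fun i => nth 0 [tuple u i | i < t] i) t = r by rewrite nthE.
apply: eq_info_state => i it.
- rewrite -[i]/(val (Ordinal (it : (i < t.+1)%N))) -tnth_nth.
  by rewrite tnth_mktuple.
- by rewrite -[i]/(val (Ordinal it)) -tnth_nth tnth_mktuple.
Qed.

(** * From certificates to gain bounds *)

(** Worst-case net cost up to and including the current instant, for a
    disturbance that is currently zero. *)
Definition peak_cost {R : realType} (y u : R) (r : R * R) : R :=
  y ^+ 2 + u ^+ 2 + Num.max r.1 r.2.

(** A predicate on the information state that the policy keeps true forces
    the gain bound: the net cost of any trajectory is below the peak cost, and
    the bias of [x] is a bound certified at the initial state with measurement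
    |x|. The certificate may depend on time, as needed when the policy is only
    nearly optimal. *)
Lemma gain_of_certificate {R : realType} (gamma : R)
    (eta : nat -> {nonneg R} -> R -> R -> R)
    (cert : R -> nat -> {nonneg R} -> R * R -> Prop) :
  (forall y, exists v, cert v 0%N y (0, 0)) ->
  (forall v t y r, cert v t y r ->
     peak_cost y%:num (eta t y r.1 r.2) r <= v) ->
  (forall v t y r y', cert v t y r ->
     cert v t.+1 y' (info_next gamma y%:num (eta t y r.1 r.2) y'%:num r)) ->
  ensures_l2_gain (info_policy gamma eta) gamma.
Proof.
move=> /choice[v certv] cert_le certS.
exists (v \o measurement (R := R)) => w x u loop N.
have xS t : x t.+1 = x t + u t + w t by case: (loop t).
pose r := info_state gamma (fun i => `|x i|) u.
have uE t : u t = eta t (measurement (x t)) (r t).1 (r t).2.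
  exact: info_policy_loop loop.
have cert_t t : cert (v (measurement (x 0%N))) t (measurement (x t)) (r t).
  elim: t => [|t IH]; first exact: certv.
  by have := certS _ _ _ _ (measurement (x t.+1)) IH; rewrite -uE.
rewrite gain_net_costE //; apply: le_trans (cert_le _ _ _ _ (cert_t N)).
rewrite net_costS -uE /peak_cost /= real_normK ?num_real //.
have [lep lem] := net_cost_le_info gamma x u N.
have le_max_r : net_cost gamma x u N <= Num.max (r N).1 (r N).2.
  rewrite le_max; apply/orP.
  case: (ger0P (x N)) lep lem => _ lep lem; [left; exact: lep | right].
  by apply: lem; rewrite opprK.
have : 0 <= gamma ^+ 2 * (x N.+1 - x N - u N) ^+ 2.
  by rewrite mulr_ge0 ?sqr_ge0.
by lra.
Qed.

(** * The dynamic game on information states *)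

(** Greatest fixed point, in impredicative form, of the condition that some
    control costs at most [b] and remains winning for every next
    measurement. Quantifying over invariant sets avoids strategies, and with
    them any dependence on time or on the past. *)
Definition winning {R : realType} (gamma b : R) (s : {nonneg R} * (R * R)) :
    Prop :=
  exists2 Q : {nonneg R} * (R * R) -> Prop, Q s &
  forall y r, Q (y, r) -> exists2 u, peak_cost y%:num u r <= b &
    forall y' : {nonneg R}, Q (y', info_next gamma y%:num u y'%:num r).

Lemma winning_step {R : realType} (gamma b : R) (y : {nonneg R}) (r : R * R) :
  winning gamma b (y, r) -> exists2 u, peak_cost y%:num u r <= b &
    forall y' : {nonneg R},
      winning gamma b (y', info_next gamma y%:num u y'%:num r).
Proof.
by move=> [Q Qs Qstep]; have [u ub Qn] := Qstep _ _ Qs; exists u => // y'; exists Q.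
Qed.

Lemma winning_le {R : realType} (gamma b b' : R) (s : {nonneg R} * (R * R)) :
  b <= b' -> winning gamma b s -> winning gamma b' s.
Proof.
move=> bb' [Q Qs Qstep]; exists Q => // y r /Qstep[u ub Qn].
by exists u => //; apply: le_trans bb'.
Qed.

(** The states visited by running the policy on all measurement sequences
    starting at [y0] form an invariant set. The hidden initial state may be
    either of [y0] and [- y0], hence the maximum of two biases. *)
Lemma winning_of_gain {R : realType} (gamma : R) (mu : policy R)
    (y0 : {nonneg R}) :
  ensures_l2_gain mu gamma -> exists b, winning gamma b (y0, (0, 0)).
Proof.
move=> [beta gain]; exists (Num.max (beta y0%:num) (beta (- y0%:num))).
pose state (y : nat -> {nonneg R}) t :=
  (y t, info_state gamma (fun i => (y i)%:num) (control mu y) t).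
exists (fun s => exists (y : nat -> {nonneg R}) (t : nat),
    y 0%N = y0 /\ s = state y t).
  by exists (fun=> y0), 0%N.
move=> _ _ [y [t [yE [-> ->]]]]; exists (control mu y t).
(* Cost bound: a worst-case history is continued by a step with zero
   disturbance, so that the gain inequality at horizon [t] has no loss. *)
- have history_le (x : nat -> R) : (forall i, measurement (x i) = y i) ->
      (y t)%:num ^+ 2 + control mu y t ^+ 2 + net_cost gamma x (control mu y) t
      <= Num.max (beta y0%:num) (beta (- y0%:num)).
    move=> xy; pose x' i := if (i <= t)%N then x i else x t + control mu y t.
    have x'E i : (i <= t)%N -> x' i = x i by rewrite /x' => ->.
    pose y' := measurement (R := R) \o x'.
    have uE i : (i <= t)%N -> control mu y' i = control mu y i.
      move=> it; apply: eq_control => j ji.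
      by rewrite /y' /= x'E ?xy // (leq_trans ji it).
    have loop := closed_loop_control mu x'.
    have x'S s : x' s.+1 =
        x' s + control mu y' s + (x' s.+1 - x' s - control mu y' s) by ring.
    have := gain _ _ _ loop t; rewrite gain_net_costE // net_costS.
    rewrite (eq_net_cost gamma x' x (control mu y') (control mu y) t) //; last first.
      by move=> i it; apply: uE; apply: ltnW.
    rewrite -/y' uE // (x'E t) // (x'E 0%N) // {1}/x' ltnn.
    have -> : x t + control mu y t - x t - control mu y t = 0 by ring.
    have -> : x t ^+ 2 = (y t)%:num ^+ 2.
      by rewrite -xy /= real_normK ?num_real.
    rewrite expr0n mulr0 subr0 addrC => /le_trans; apply.
    have <- : `|x 0%N| = y0%:num by rewrite -yE -xy.
    by rewrite le_max; case: (ger0P (x 0%N)) => _; rewrite ?opprK lexx ?orbT.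
  have [[xp [xpy _ xpr]] [xm [xmy _ xmr]]] :=
    worst_case_history gamma y (control mu y) t.
  rewrite /peak_cost -xpr -xmr; case: (leP (net_cost gamma xp _ t)) => _.
    exact: history_le.
  exact: history_le.
(* Invariance: by causality, the measurement after [t] can be changed to [y1]
   without affecting the game up to [t]. *)
- move=> y1; pose y' i := if (i <= t)%N then y i else y1.
  have y'E i : (i <= t)%N -> y' i = y i by rewrite /y' => ->.
  exists y', t.+1; split; first by rewrite y'E.
  have uE i : (i <= t)%N -> control mu y' i = control mu y i.
    by move=> it; apply: eq_control => j ji; rewrite y'E // (leq_trans ji it).
  rewrite /state info_stateS uE // (y'E t) //.
  rewrite (eq_info_state gamma (fun i => (y' i)%:num) (fun i => (y i)%:num)
             (control mu y') (control mu y)) //.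
  + by rewrite /y' ltnn.
  + by move=> i it; rewrite y'E.
  + by move=> i it; rewrite uE // ltnW.
Qed.

(** One control serves all achievable bounds [b] at once, up to [e]: it is
    taken from a bound within [e] of their infimum. Thus it depends on the
    state alone, not on the bound to be met. *)
Lemma near_optimal_control {R : realType} (gamma e : R) (y : {nonneg R})
    (r : R * R) :
  0 < e -> exists u, forall b, winning gamma b (y, r) ->
    peak_cost y%:num u r <= b + e /\
    forall y' : {nonneg R},
      winning gamma (b + e) (y', info_next gamma y%:num u y'%:num r).
Proof.
move=> e0; pose B : set R := [set b | winning gamma b (y, r)]%classic.
have [[b0 Bb0]|nB] := pselect (exists b, B b); last first.
  by exists 0 => b Bb; case: nB; exists b.
have infB : has_inf B.
  split; first by exists b0.
  exists (Num.max r.1 r.2) => b /winning_step[u ub _]; apply: le_trans ub.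
  by rewrite lerDr addr_ge0 ?sqr_ge0.
have [b Bb b_lt] := inf_adherent e0 infB.
have [u ub un] := winning_step _ _ _ _ Bb; exists u => b1 Bb1.
have le_b : b <= b1 + e.
  by apply: le_trans (ltW b_lt) _; rewrite lerD2r; apply: ge_inf => //; case: infB.
by split=> [|y']; [apply: le_trans le_b | apply: winning_le (un y')].
Qed.

(** The budget [v] starts 1 above an achievable bound, and after [t] steps
    2^-t of this slack is left; the step at time [t] spends 2^-(t+1). *)
Lemma info_policy_of_policy {R : realType} (gamma : R) (mu : policy R) :
  ensures_l2_gain mu gamma ->
  exists eta : nat -> {nonneg R} -> R -> R -> R,
    ensures_l2_gain (info_policy gamma eta) gamma.
Proof.
move=> gain; pose e (t : nat) : R := 2 ^- t.
have e_gt0 t : 0 < e t by rewrite invr_gt0 exprn_gt0.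
have e_half t : e t = e t.+1 + e t.+1.
  by rewrite /e exprS invfM; field; rewrite expf_neq0.
have [f fP] := choice (fun s : nat * ({nonneg R} * (R * R)) =>
  near_optimal_control gamma (e s.1.+1) s.2.1 s.2.2 (e_gt0 _)).
exists (fun t y rp rm => f (t, (y, (rp, rm)))).
apply: (gain_of_certificate gamma _
  (fun v t y r => winning gamma (v - e t) (y, r))).
- move=> y; have [b win] := winning_of_gain gamma mu y gain.
  by exists (b + e 0%N); rewrite addrK.
- move=> v t y [rp rm] win; have [le_b _] := fP (t, (y, (rp, rm))) _ win.
  by apply: le_trans le_b _; rewrite e_half /=; have := e_gt0 t.+1; lra.
- move=> v t y [rp rm] y' win.
  have [_ /(_ y')] := fP (t, (y, (rp, rm))) _ win.
  by rewrite (_ : v - e t + e t.+1 = v - e t.+1) // e_half; ring.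
Qed.

(** * The threshold controller *)

(** This bounds max (max r + a y^2, min r + b y^2) by [v], with a = 1.7 and
    b = 7. Maximizing over the next measurement, invariance under a correct
    guess of the sign asks for 1.49 + 0.09 * 16 a / (16 - a) <= a, and under a
    wrong guess for 1.49 + 2.89 * 16 a / (16 - a) <= b. *)
Definition quadratic_cert {R : realType} (v y : R) (r : R * R) : Prop :=
  [/\ r.1 + 17 / 10 * y ^+ 2 <= v, r.2 + 17 / 10 * y ^+ 2 <= v &
      r.1 + 7 * y ^+ 2 <= v \/ r.2 + 7 * y ^+ 2 <= v].

Lemma quadratic_cert_swap {R : realType} (v y p m : R) :
  quadratic_cert v y (p, m) -> quadratic_cert v y (m, p).
Proof. by case=> /= ? ? [?|?]; split=> //; [right | left]. Qed.

Lemma info_next_swap {R : realType} (gamma y u y' p m : R) :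
  info_next gamma y (- u) y' (m, p) =
  ((info_next gamma y u y' (p, m)).2, (info_next gamma y u y' (p, m)).1).
Proof.
rewrite /info_next /= sqrrN; congr (_, _); congr (_ + _); rewrite maxC;
  by congr Num.max; congr (_ - _ * _); ring.
Qed.

(** If x = y, the control leaves 0.3 y; otherwise it drives the state to
    - 1.7 y. *)
Lemma quadratic_cert_step {R : realType} (v y y' p m : R) :
  0 <= y -> 0 <= y' -> m <= p -> quadratic_cert v y (p, m) ->
  quadratic_cert v y' (info_next 4 y (- (7 / 10 * y)) y' (p, m)).
Proof.
move=> y0 y'0 mp [/= pv _ /= or7].
have mv : m + 7 * y ^+ 2 <= v by case: or7 => // ?; lra.
have yy' : 0 <= y * y' by rewrite mulr_ge0.
have y2 := sqr_ge0 y; have y'2 := sqr_ge0 y'.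
have le_addmax a b c d : (a + Num.max b c + d <= v) =
    (a + b + d <= v) && (a + c + d <= v).
  by rewrite -lerBrDr -lerBrDl ge_max; congr andb; rewrite lerBrDl lerBrDr.
(* The squares supplied below vanish at the least favourable y': 48/143 y when
   x = y, 272/143 y when x = - y. *)
split; rewrite /= ?le_addmax.
- by have := sqr_ge0 (143 * y' - 48 * y); move=> *; apply/andP; split; lra.
- by have := sqr_ge0 (143 * y' - 272 * y); move=> *; apply/andP; split; lra.
(* If both bounds with coefficient 7 failed, the critical case would be that
   next r^+ comes from x = y and next r^- from x = - y. Averaging these two
   branches with weights 9/10 and 1/10 rules it out: the cross term in y * y'
   is then 9/10 * 0.3 + 1/10 * 1.7 = 11/25, which gives the square. *)
- have := sqr_ge0 (9 * y' - 176 / 25 * y) => mixed; apply/orP.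
  by do !(case: lerP => ? //=); exfalso; lra.
Qed.

(** At a tie r^+ = r^- the step lemma applies to either guess of the sign.
    Swapping r^+ and r^- while negating the control reduces r^+ <= r^- to
    r^- <= r^+. *)
Lemma threshold_controller_gain {R : realType} (s0 : R) :
  s0 = 1 \/ s0 = -1 ->
  ensures_l2_gain
    (info_policy 4
       (fun (_ : nat) (y : {nonneg R}) (rp rm : R) =>
          7 / 10 * sign s0 (rm - rp) * y%:num))
    4.
Proof.
move=> s0E.
have signP p m : (sign s0 (m - p) = -1 /\ m <= p) \/
                 (sign s0 (m - p) = 1 /\ p <= m).
  rewrite /sign; case: (ltgtP 0 (m - p)) => [mp|mp|mp].
  - by right; split=> //; lra.
  - by left; split=> //; lra.
  - by case: s0E => ->; [right | left]; split=> //; lra.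
apply: (gain_of_certificate 4 _ (fun v _ y r => quadratic_cert v y%:num r)).
- move=> y; exists (7 * y%:num ^+ 2); have := sqr_ge0 y%:num.
  by split=> /=; [lra | lra | left; lra].
- move=> v _ y [p m] [/= pv mv _]; have := sqr_ge0 y%:num.
  rewrite /peak_cost -lerBrDl ge_max /=.
  by case: (signP p m) => -[-> _] y2; apply/andP; split; lra.
- move=> v _ y [p m] y' /= cert.
  case: (signP p m) => -[-> le_r].
  + rewrite mulrN1 mulNr; exact: quadratic_cert_step.
  + rewrite mulr1 -[7 / 10 * _]opprK info_next_swap.
    apply/quadratic_cert_swap; rewrite -surjective_pairing.
    by apply: quadratic_cert_step => //; apply: quadratic_cert_swap.
Qed.

Theorem proposition1 (R : realType) :
  (forall gamma : R, 0 < gamma ->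
     ((exists mu : policy R, ensures_l2_gain mu gamma) <->
      (exists eta : nat -> {nonneg R} -> R -> R -> R,
         ensures_l2_gain (info_policy gamma eta) gamma))) /\
  (forall s0 : R, s0 = 1 \/ s0 = -1 ->
     ensures_l2_gain
       (info_policy 4
          (fun (_ : nat) (y : {nonneg R}) (rp rm : R) =>
             7 / 10 * sign s0 (rm - rp) * y%:num))
       4).
Proof.
split=> [gamma _|s0]; last exact: threshold_controller_gain.
split=> [[mu]|[eta gain]]; first exact: info_policy_of_policy.
by exists (info_policy gamma eta).
Qed.
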